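(* Let $\mathbf{V}$ be a variety of bands. Then the following are equivalent: (1) for every band $B\in\mathbf{V}$, all maximal subgroups of the free idempotent generated semigroup $\mathsf{IG}(B)$ are free groups; (2) $\mathbf{V}$ is contained either in $\mathbf{LSNB}$ (the variety of left seminormal bands) or in $\mathbf{RSNB}$ (the variety of right seminormal bands).
   Context: A band is a semigroup $B$ in which every element is idempotent ($x^2=x$ for all $x\in B$); a variety of bands is a class of bands defined by identities. $\mathbf{RSNB}$, the variety of right seminormal bands, is the variety of all bands satisfying the identity $tuv=tvtuv$. $\mathbf{LSNB}$, the variety of left seminormal bands, is its left-right dual: the variety of all bands satisfying the identity $vut=vutvt$. For a semigroup $S$ with set of idempotents $E=E(S)$, a pair of idempotents $e,f\in E$ (with $e=f$ allowed) is a basic pair if $\{ef,fe\}\cap\{e,f\}\neq\varnothing$ (products in $S$); in that case both $ef$ and $fe$ are idempotents of $S$. The free idempotent generated semigroup over $E$ is the semigroup given by the presentation $$\mathsf{IG}(E)=\langle E \mid e\cdot f=ef \text{ for all } e,f\in E \text{ such that } \{e,f\} \text{ is a basic pair}\rangle,$$ where $\cdot$ is concatenation in the free semigroup $E^+$ and $ef$ denotes the product of $e$ and $f$ in $S$, viewed as a single generator. For a band $B$ we have $E(B)=B$, and $\mathsf{IG}(B)$ denotes $\mathsf{IG}(E(B))$. The maximal subgroups of a semigroup are its subgroups that are maximal under inclusion, i.e. its $\mathcal{H}$-classes that contain an idempotent. The trivial group counts as a free group (of rank $0$). *)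

(* Defs.v *)
From HB Require Import structures.
From mathcomp Require Import all_boot.
From mathcomp Require Import boolp classical_sets.
Set Implicit Arguments.
Unset Strict Implicit.
Unset Printing Implicit Defensive.
Local Open Scope classical_set_scope.
Local Open Scope quotient_scope.
Local Open Scope group_scope.

(* The free semigroup A^+: the pair (a, s) stands for the nonempty word
   a :: s, and the product is concatenation. *)
Definition word (A : choiceType) : Type := (A * seq A)%type.
HB.instance Definition _ (A : choiceType) := Choice.on (word A).

Definition letter (A : choiceType) (a : A) : word A := (a, [::]).

Definition word_mul (A : choiceType) (u v : word A) : word A :=
  (u.1, u.2 ++ v.1 :: v.2).

Fact word_mulA (A : choiceType) : associative (@word_mul A).
Proof. by move=> u v w; rewrite /word_mul /= -catA. Qed.

HB.instance Definition _ (A : choiceType) :=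
  isSemigroup.Build (word A) (@word_mulA A).

(* the homomorphic extension of s : A -> S to the free semigroup *)
Definition word_eval (A : choiceType) (S : semigroupType) (s : A -> S)
    (w : word A) : S :=
  foldl (fun x a => x * s a) (s w.1) w.2.

Section Quotient.
Variables (S : semigroupType) (R : S -> S -> Prop).

Inductive congruence_closure : S -> S -> Prop :=
| CongIn x y of R x y : congruence_closure x y
| CongRefl x : congruence_closure x x
| CongSym x y of congruence_closure x y : congruence_closure y x
| CongTrans y x z of congruence_closure x y & congruence_closure y z :
    congruence_closure x z
| CongMul x x' y y' of congruence_closure x x' & congruence_closure y y' :
    congruence_closure (x * y) (x' * y').

Definition cong_rel : rel S := fun x y => `[< congruence_closure x y >].

Fact cong_rel_refl : reflexive cong_rel.
Proof. by move=> x; apply/asboolP; apply: CongRefl. Qed.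

Fact cong_rel_sym : symmetric cong_rel.
Proof. by move=> x y; apply/asboolP/asboolP; apply: CongSym. Qed.

Fact cong_rel_trans : transitive cong_rel.
Proof. by move=> y x z /asboolP xy /asboolP yz; apply/asboolP/(CongTrans xy). Qed.

Canonical cong_equiv :=
  EquivRel cong_rel cong_rel_refl cong_rel_sym cong_rel_trans.

Definition quot_semigroup : Type := {eq_quot cong_equiv}.
HB.instance Definition _ := Choice.on quot_semigroup.
HB.instance Definition _ := EqQuotient.on quot_semigroup.

Definition quot_mul (x y : quot_semigroup) : quot_semigroup :=
  \pi_quot_semigroup (repr x * repr y).

Fact quot_semigroupP x y :
  x = y %[mod quot_semigroup] <-> congruence_closure x y.
Proof.
split=> [/(@eqquotP _ _ quot_semigroup)/asboolP //|xy].
by apply/(@eqquotP _ _ quot_semigroup)/asboolP.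
Qed.

Fact quot_mul_pi x y :
  quot_mul (\pi_quot_semigroup x) (\pi_quot_semigroup y) =
  \pi_quot_semigroup (x * y).
Proof. by apply/quot_semigroupP/CongMul; apply/quot_semigroupP; rewrite reprK. Qed.

Fact quot_mulA : associative quot_mul.
Proof.
move=> x y z; rewrite -(reprK x) -(reprK y) -(reprK z).
rewrite (quot_mul_pi (repr y)) (quot_mul_pi (repr x) (repr y)).
by rewrite (quot_mul_pi (repr x)) quot_mul_pi mulgA.
Qed.

HB.instance Definition _ := isSemigroup.Build quot_semigroup quot_mulA.

End Quotient.

Definition presented_semigroup (A : choiceType)
    (R : word A -> word A -> Prop) : semigroupType := quot_semigroup R.

Definition idempotents (S : semigroupType) : choiceType :=
  {e : S | e * e == e}.

Definition basic_pair (S : semigroupType) (e f : S) : Prop :=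
  [set e * f; f * e] `&` [set e; f] !=set0.

(* As the product of a basic pair of idempotents is idempotent, there is
   exactly one admissible generator g for each basic pair {e, f}. *)
Definition IG_rel (S : semigroupType) (u v : word (idempotents S)) : Prop :=
  exists e f g : idempotents S,
    [/\ basic_pair (val e) (val f), val g = val e * val f,
        u = letter e * letter f & v = letter g].

Definition IG (S : semigroupType) : semigroupType :=
  presented_semigroup (@IG_rel S).

Definition subgroup (S : semigroupType) (H : set S) : Prop :=
  (forall x y, H x -> H y -> H (x * y)) /\
  exists e, [/\ H e,
    forall x, H x -> e * x = x /\ x * e = x &
    forall x, H x -> exists y, [/\ H y, x * y = e & y * x = e]].

Definition maximal_subgroup (S : semigroupType) (H : set S) : Prop :=
  subgroup H /\ forall K : set S, subgroup K -> H `<=` K -> K = H.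

(* X is a basis of G: only the values of f on X are relevant, so f ranges in
   effect over all maps X -> K. *)
Definition free_basis (G : groupType) (X : set G) : Prop :=
  forall (K : groupType) (f : G -> K),
    (exists phi : {multiplicative G -> K}, forall x, X x -> phi x = f x) /\
    (forall phi psi : {multiplicative G -> K},
       (forall x, X x -> phi x = f x) -> (forall x, X x -> psi x = f x) ->
       phi =1 psi).

Definition free_group (G : groupType) : Prop :=
  exists X : set G, free_basis X.

(* A subset of a semigroup is a free group when it is the isomorphic image of
   a free group under multiplication. *)
Definition is_free_group (S : semigroupType) (H : set S) : Prop :=
  exists (G : groupType) (f : {multiplicative G -> S}),
    [/\ free_group G, injective f & range f = H].

Definition band (S : semigroupType) : Prop := forall x : S, x * x = x.

(* An identity is a pair of words over countably many variables, indexed by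
   nat. *)
Definition satisfies (S : semigroupType) (I : word nat * word nat) : Prop :=
  forall s : nat -> S, word_eval s I.1 = word_eval s I.2.

Definition band_variety (V : semigroupType -> Prop) : Prop :=
  exists Sigma : set (word nat * word nat), forall S : semigroupType,
    V S <-> band S /\ forall I, Sigma I -> satisfies S I.

Definition RSNB (S : semigroupType) : Prop :=
  band S /\ forall t u v : S, t * u * v = t * v * t * u * v.

Definition LSNB (S : semigroupType) : Prop :=
  band S /\ forall t u v : S, v * u * t = v * u * t * v * t.

(* Main.v *)
Require Import Defs.
From HB Require Import structures.
From mathcomp Require Import all_boot.
From mathcomp Require Import boolp classical_sets.

Set Implicit Arguments.
Unset Strict Implicit.
Unset Printing Implicit Defensive.
Local Open Scope classical_set_scope.
Local Open Scope quotient_scope.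
Local Open Scope group_scope.

(** Write [c] for the generator of IG(B) attached to an element c of a band B.
    The J-order of B, here [below], makes B a semilattice of rectangular bands
    I x L, its J-classes.

    From (2) to (1). As IG(B) is anti-isomorphic to IG of the opposite band, one
    may assume that B is right seminormal. An idempotent of IG(B) can be written
    as a word with a letter in the least class of its letters
    ([idempotent_core]: otherwise the number of runs of letters of two kinds
    would grow when the word is squared), and then with all its letters in that
    class. The subsemigroup generated by one class I x L is completely simple,
    so every maximal subgroup is the set H_e of those products of letters of the
    class of some e whose value in B is e ([maximal_subgroup_core]). Normalised
    at e, the group H_e is generated by the sandwich entries p(m, n) = [m][n],
    where m runs through the row of e and n through its column, and its
    relations come from the elements c above the class: c moves the rows I and
    the columns L, and identifies some ratios of sandwich entries. Right
    seminormality says exactly that every c above the class maps all of I to a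
    single row ([row_constant]). Then the only effect of c is p(m1, n) = p(m2,
    n) for all n, whenever m1 and m2 are fixed by c on the right
    ([column_identified]). As all relations have the form generator = generator
    or generator = 1, the entries different from 1 form a basis: any map from
    them to a group K extends to H_e through the action of IG(B) on L x K given
    by the Rees matrix construction ([extension_exists]).

    From (1) to (2).  If V is contained in neither variety, its identities hold
    in the two-element right zero band with an identity adjoined and in its
    dual ([satisfies_right_zero1], [satisfies_opposite_right_zero1]), hence in
    every subdirect product of copies of these.  One of them is the direct
    product of the 2 x 2 rectangular band by the 2 x 2 rectangular band with
    an identity adjoined.  Its lowest class is 4 x 4, the graph of the sandwich
    matrix is K(4, 4), and the squares contributed by the four upper elements
    are the eight faces of an embedding of K(4, 4) in the torus, so that the
    maximal subgroup at the bottom is Z x Z.  It suffices to find in it two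
    commuting elements ([torus_commute]) whose winding numbers modulo 2 are
    (1, 0) and (0, 1) ([winding_number]): in a free group such elements do not
    commute, since the two winding numbers lift to a homomorphism to the
    Heisenberg group over F_2 ([free_group_not_commute]). *)

(** * Subgroups of a semigroup as groups *)

Section SubgroupGroup.
Variables (S : semigroupType) (H : set S) (hH : subgroup H).

(** The proof that [H] is a subgroup is a parameter, although the carrier does
    not depend on it, so that the group structure can be inferred. *)
Definition subgroup_group (hH' : subgroup H) : Type := {x : S | `[< H x >]}.
Local Notation G := (subgroup_group hH).
HB.instance Definition _ := Choice.on G.

Definition sgval (x : G) : S := val x.
Definition sgmk x (hx : H x) : G := exist _ x (introT (asboolP _) hx).

Lemma sgvalP (x : G) : H (sgval x).
Proof. exact: (asboolW (valP x)). Qed.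

Lemma sgval_inj : injective sgval.
Proof. exact: val_inj. Qed.

Let e : S := projT1 (cid hH.2).
Let he : [/\ H e, forall x, H x -> e * x = x /\ x * e = x &
    forall x, H x -> exists y, [/\ H y, x * y = e & y * x = e]] :=
  projT2 (cid hH.2).
Let he1 : H e. Proof. by case: he. Qed.
Let hinv (x : G) : exists y, [/\ H y, sgval x * y = e & y * sgval x = e].
Proof. by case: he => _ _; apply; apply: sgvalP. Qed.
Let inv (x : G) : S := projT1 (cid (hinv x)).
Let invP (x : G) : [/\ H (inv x), sgval x * inv x = e & inv x * sgval x = e] :=
  projT2 (cid (hinv x)).
Let invH (x : G) : H (inv x). Proof. by case: (invP x). Qed.

Definition sg_mul (x y : G) : G := sgmk (hH.1 _ _ (sgvalP x) (sgvalP y)).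
Definition sg_one : G := sgmk he1.
Definition sg_inv (x : G) : G := sgmk (invH x).

Fact sg_mulA : associative sg_mul.
Proof. by move=> x y z; apply: sgval_inj; apply: mulgA. Qed.
Fact sg_mul1 : left_id sg_one sg_mul.
Proof.
by move=> x; apply: sgval_inj => /=; case: he => _ /(_ _ (sgvalP x))[].
Qed.
Fact sg_1mul : right_id sg_one sg_mul.
Proof.
by move=> x; apply: sgval_inj => /=; case: he => _ /(_ _ (sgvalP x))[].
Qed.
Fact sg_mulV : left_inverse sg_one sg_inv sg_mul.
Proof. by move=> x; apply: sgval_inj => /=; case: (invP x). Qed.
Fact sg_Vmul : right_inverse sg_one sg_inv sg_mul.
Proof. by move=> x; apply: sgval_inj => /=; case: (invP x). Qed.

HB.instance Definition _ :=
  isGroup.Build G sg_mulA sg_mul1 sg_1mul sg_mulV sg_Vmul.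

Fact sgvalM : {morph sgval : x y / x * y}.
Proof. by []. Qed.
HB.instance Definition _ := isMultiplicative.Build G S sgval sgvalM.

Lemma sgval1 u : H u -> u * u = u -> sgval 1 = u.
Proof.
move=> Hu uu; have -> : 1 = sgmk Hu :> G; last by [].
by apply: (@mulgI G (sgmk Hu)); rewrite mulg1; apply: sgval_inj.
Qed.

Lemma free_subgroup : free_group G -> is_free_group H.
Proof.
move=> fG; exists G, sgval; split=> //; first exact: sgval_inj.
apply/seteqP; split=> [_ [x _ <-]|x hx]; first exact: sgvalP.
by exists (sgmk hx).
Qed.

End SubgroupGroup.

Lemma multiplicative1 (G K : groupType) (f : {multiplicative G -> K}) : f 1 = 1.
Proof. by apply: (@mulgI K (f 1)); rewrite -gmulfM !mulg1. Qed.

Lemma multiplicativeV (G K : groupType) (f : {multiplicative G -> K}) x :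
  f x^-1 = (f x)^-1.
Proof. by apply: (@mulgI K (f x)); rewrite -gmulfM !mulgV multiplicative1. Qed.

(** * Bands as semilattices of rectangular bands *)

(** The J-order: in a band, a lies in the ideal generated by b if and only if
    a b a = a. *)
Definition below (S : semigroupType) (a b : S) : Prop := a * b * a = a.

Section Bands.
Variables (S : semigroupType) (hS : band S).
Implicit Types a b c d e x y z : S.

Lemma band_idem_r x y : y * x * x = y * x.
Proof. by rewrite -mulgA hS. Qed.

Lemma band_idem2 x y : x * y * x * y = x * y.
Proof. by rewrite -mulgA hS. Qed.

Lemma below_refl a : below a a.
Proof. by rewrite /below !hS. Qed.

(** Expand the square of d e c between two copies of e. *)
Lemma below_mul e c d : below e c -> below e d -> below e (c * d).
Proof.
rewrite /below => ec ed.
have := congr1 (fun z => e * z * e) (hS (d * e * c)); rewrite /= !mulgA ed ec.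
by rewrite -(mulgA (e * c * d)) -(mulgA (e * c * d)) ec.
Qed.

Lemma below_mull e c d : below e (c * d) -> below e c.
Proof.
by rewrite /below !mulgA => h; rewrite -{2}h !mulgA band_idem2 h.
Qed.

Lemma below_mulr e c d : below e (c * d) -> below e d.
Proof.
rewrite /below !mulgA => h.
by rewrite -{1}h -!mulgA (mulgA d e (d * e)) hS !mulgA h.
Qed.

Lemma below_trans b a c : below a b -> below b c -> below a c.
Proof.
rewrite {2}/below => ab bcb; move: ab; rewrite -bcb.
by move/below_mull/below_mulr.
Qed.

Lemma below_mulrr x y : below (x * y) y.
Proof. by rewrite /below band_idem_r hS. Qed.

Lemma below_mulrl x y : below (x * y) x.
Proof. by rewrite /below !mulgA band_idem_r band_idem2. Qed.

Definition same_class c d : Prop := below c d /\ below d c.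

Lemma same_class_refl c : same_class c c.
Proof. by split; apply: below_refl. Qed.

Lemma same_class_sym c d : same_class c d -> same_class d c.
Proof. by case. Qed.

Lemma same_class_trans b a c :
  same_class a b -> same_class b c -> same_class a c.
Proof. by move=> [ab ba] [bc cb]; split; apply: below_trans; eassumption. Qed.

Lemma same_class_absorb_r b f d :
  same_class b f -> below b d -> same_class b (f * d).
Proof.
move=> [bf fb] bd; split; first exact: below_mul.
exact: below_trans (below_mulrl _ _) fb.
Qed.

Lemma same_class_absorb_l b f d :
  same_class b f -> below b d -> same_class b (d * f).
Proof.
move=> [bf fb] bd; split; first exact: below_mul.
exact: below_trans (below_mulrr _ _) fb.
Qed.

Lemma same_class_mul b c d :
  same_class b c -> same_class b d -> same_class b (c * d).
Proof. by move=> bc [bd _]; apply: same_class_absorb_r. Qed.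

Lemma class_below b f d : same_class b f -> below b d -> below f d.
Proof. by move=> [_ fb]; apply: below_trans. Qed.

(** As z lies below x y, one has x z = x (z x y z), and x z x = x. *)
Lemma rectangular b x y z : same_class b x -> same_class b y ->
  same_class b z -> x * y * z = x * z.
Proof.
move=> bx by_ bz.
have xz : x * z * x = x by apply: (class_below bx); case: bz.
have zxy : z * (x * y) * z = z.
  by apply: (class_below bz); case: (same_class_mul bx by_).
by rewrite -{2}zxy !mulgA xz.
Qed.

Lemma basic_pairP c d :
  basic_pair c d <-> [\/ c * d = c, c * d = d, d * c = c | d * c = d].
Proof.
split=> [[x [/= [->|->]] [->|->]]|[] h].
- exact: Or41.
- exact: Or42.
- exact: Or43.
- exact: Or44.
- by exists (c * d); split; [left | left].
- by exists (c * d); split; [left | right].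
- by exists (d * c); split; [right | left].
- by exists (d * c); split; [right | right].
Qed.

(** The letters of a basic pair are comparable, and its product lies in the
    class of the lower one: multiplying out a basic pair in a word only drops
    the upper class from the sequence of classes. *)
Lemma basic_pair_class c d : basic_pair c d ->
  (below c d /\ same_class c (c * d)) \/ (below d c /\ same_class d (c * d)).
Proof.
have lcl x y : below x y -> same_class x (x * y).
  by move=> xy; apply: same_class_absorb_r => //; apply: same_class_refl.
have lcr x y : below x y -> same_class x (y * x).
  by move=> xy; apply: same_class_absorb_l => //; apply: same_class_refl.
move=> /basic_pairP[] h.
- have cd : below c d by rewrite /below h hS.
  by left; split=> //; apply: lcl.
- have dc : below d c by rewrite /below -mulgA h hS.
  by right; split=> //; apply: lcr.
- have cd : below c d by rewrite /below -mulgA h hS.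
  by left; split=> //; apply: lcl.
- have dc : below d c by rewrite /below h hS.
  by right; split=> //; apply: lcr.
Qed.

End Bands.

(** * The universal property of IG of a band *)

(** The properties of IG(S) on which the proof relies: the relations hold, the
    letters generate, and every action of the letters on a set that is
    compatible with the relations extends.  Unlike the presentation, they are
    visibly invariant under reversal of the products, and actions avoid the
    need for a semigroup of transformations. *)
Definition ig_like (S T : semigroupType) (i : S -> T) : Prop :=
  [/\ forall c d, basic_pair c d -> i (c * d) = i c * i d,
      forall P : T -> Prop, (forall d, P (i d)) ->
        (forall x y, P x -> P y -> P (x * y)) -> forall x, P x
    & forall (St : Type) (act : S -> St -> St),
        (forall c d s, basic_pair c d -> act (c * d) s = act d (act c s)) ->
        exists run : T -> St -> St, (forall d s, run (i d) s = act d s) /\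
          forall x y s, run (x * y) s = run y (run x s)].

Lemma word_eval_mul (A : choiceType) (S : semigroupType) (s : A -> S) u v :
  word_eval s (word_mul u v) = word_eval s u * word_eval s v.
Proof.
case: u v => [a u] [b v]; rewrite /word_eval /= foldl_cat /=.
elim/last_ind: v => [//|v c IH].
by rewrite -!cats1 !foldl_cat /= IH mulgA.
Qed.

Section IGLike.
Variables (S T : semigroupType) (i : S -> T).
Hypotheses (hS : band S) (hi : ig_like i).

Lemma ig_mul c d : [\/ c * d = c, c * d = d, d * c = c | d * c = d] ->
  i c * i d = i (c * d).
Proof. by case: hi => h _ _ /basic_pairP/h. Qed.

Lemma ig_idem d : i d * i d = i d.
Proof. by rewrite ig_mul ?hS //; apply: Or41. Qed.

Lemma ig_word x : exists w : word S, x = word_eval i w.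
Proof.
case: hi => _ ind _; apply: (ind (fun x => exists w : word S, x = word_eval i w)).
  by move=> d; exists (letter d).
by move=> _ _ [u ->] [v ->]; exists (word_mul u v); rewrite word_eval_mul.
Qed.

(** The action is right multiplication on S with an identity [None] adjoined,
    which makes the action faithful. *)
Lemma ig_proj : exists proj : T -> S, (forall d, proj (i d) = d) /\
  forall x y, proj (x * y) = proj x * proj y.
Proof.
case: hi => _ ind.
move/(_ (option S) (fun d o => Some (if o is Some m then m * d else d))).
case=> [c d [m|] _|run [run_i run_mul]]; rewrite ?mulgA //.
have h x : exists m, forall o, run x o = Some (if o is Some n then n * m else m).
  apply: (ind (fun x => exists m, forall o,
    run x o = Some (if o is Some n then n * m else m))) => [d|y z [m hm] [n hn]].
    by exists d => o; rewrite run_i.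
  by exists (m * n) => o; rewrite run_mul hm hn; case: o => [p|] //; rewrite mulgA.
have [proj hp] := choice h; exists proj; split=> [d|x y].
  by have := hp (i d) None; rewrite run_i => -[].
by have := run_mul x y None; rewrite !hp => -[].
Qed.

(** * Idempotents of IG of a band *)

Inductive generated (P : S -> Prop) : T -> Prop :=
| generated_i d of P d : generated P (i d)
| generated_mul x y of generated P x & generated P y : generated P (x * y).

Definition core b := generated (same_class b).

(** For a letter f in a class and d above it, [f][d] = [f][d f][d] = [f][d f d],
    because (f, d f) and (d f, d) are basic pairs. *)
Lemma core_absorb_r b x d : core b x -> below b d -> core b (x * i d).
Proof.
move=> cx bd; elim: x / cx => [f bf|x y cx _ _ IH]; last first.
  by rewrite -mulgA; apply: generated_mul.
have bdf := same_class_absorb_l hS bf bd.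
have fdf : f * (d * f) = f by rewrite mulgA; apply: (class_below hS bf bd).
have -> : i f = i f * i (d * f) by rewrite ig_mul ?fdf //; apply: Or41.
rewrite -mulgA ig_mul; last by apply: Or43; rewrite mulgA hS.
apply: generated_mul; apply: generated_i => //.
exact: same_class_absorb_r bdf bd.
Qed.

Lemma core_absorb_l b x d : core b x -> below b d -> core b (i d * x).
Proof.
move=> cx bd; elim: x / cx => [f bf|x y _ IH cy _]; last first.
  by rewrite mulgA; apply: generated_mul.
have bfd := same_class_absorb_r hS bf bd.
have fdf : f * d * f = f by apply: (class_below hS bf bd).
have -> : i f = i (f * d) * i f by rewrite ig_mul ?fdf //; apply: Or42.
rewrite mulgA ig_mul; last by apply: Or44; rewrite -mulgA hS.
apply: generated_mul; apply: generated_i => //.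
exact: same_class_absorb_l bfd bd.
Qed.

Lemma core_mul_above b x y :
  core b x -> generated (below b) y -> core b (x * y) /\ core b (y * x).
Proof.
move=> + gy; elim: y / gy x => [d bd|y z _ IHy _ IHz] x cx.
  by split; [apply: core_absorb_r | apply: core_absorb_l].
split; first by rewrite mulgA; apply: (IHz _ _).1; apply: (IHy _ _).1.
by rewrite -mulgA; apply: (IHy _ _).2; apply: (IHz _ _).2.
Qed.

Lemma generated_word (P : S -> Prop) w :
  (forall d, d \in w.1 :: w.2 -> P d) -> generated P (word_eval i w).
Proof.
case: w => a s /=; rewrite /word_eval /=.
elim/last_ind: s => [|s d IH] h; first by apply: generated_i; apply: h; rewrite inE.
rewrite -cats1 foldl_cat /=; apply: generated_mul.
  by apply: IH => c hc; apply: h; rewrite -rcons_cons mem_rcons inE hc orbT.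
by apply: generated_i; apply: h; rewrite -rcons_cons mem_rcons mem_head.
Qed.

Lemma core_word b w : (forall d, d \in w.1 :: w.2 -> below b d) ->
  b \in w.1 :: w.2 -> core b (word_eval i w).
Proof.
case: w => a s /=; rewrite /word_eval /=.
have ib : core b (i b) by apply: generated_i; apply: same_class_refl.
elim/last_ind: s => [|s d IH] h; first by rewrite inE => /eqP <-.
rewrite -cats1 foldl_cat /= cats1.
have hs c : c \in a :: s -> below b c.
  by move=> hc; apply: h; rewrite -rcons_cons mem_rcons inE hc orbT.
rewrite -rcons_cons mem_rcons inE => /orP[/eqP <-|bs].
  exact: (core_mul_above ib (@generated_word (below b) (a, s) hs)).2.
apply: core_absorb_r; first exact: IH.
by apply: h; rewrite -rcons_cons mem_rcons mem_head.
Qed.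

Lemma minimal_letter a (s : seq S) : exists2 b, b \in a :: s &
  forall d, d \in a :: s -> below d b -> below b d.
Proof.
elim: s a => [|c s IH] a.
  by exists a; rewrite ?mem_head // => d; rewrite inE => /eqP ->.
have [b bs hb] := IH c; have [ab|nab] := pselect (below a b).
  exists a; rewrite ?mem_head // => d; rewrite inE => /orP[/eqP -> //|ds] da.
  by apply: (below_trans hS ab); apply: hb ds _; apply: (below_trans hS da).
exists b; first by rewrite inE bs orbT.
by move=> d; rewrite inE => /orP[/eqP ->|/hb].
Qed.

(** A pair [(t, n)] records the last letter [t] of a word in two letters and the
    number [n] of its runs; [enter_run t] appends the letter [t]. *)
Definition enter_run (t : bool) (o : bool * nat) : bool * nat :=
  if o.1 == t then o else (t, o.2.+1).

(** Relative to b, letters are of four kinds: those in the class of b count as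
    [true], those incomparable to b as [false], those strictly above b are
    ignored, and those strictly below b make the count undefined.  This is an
    action compatible with the relations of IG. *)
Definition count_runs (b d : S) (o : option (bool * nat)) :
    option (bool * nat) :=
  if o is Some o then
    if `[< below b d >] then Some (if `[< below d b >] then enter_run true o else o)
    else if `[< below d b >] then None else Some (enter_run false o)
  else None.
Arguments count_runs : simpl never.

Lemma count_runs_class b c d : same_class c d -> count_runs b c = count_runs b d.
Proof.
move=> [cd dc]; apply/funext => -[o|//]; rewrite /count_runs.
have -> : `[< below b c >] = `[< below b d >].
  by apply: asbool_equiv_eq; split=> h; apply: below_trans h _.
have -> // : `[< below c b >] = `[< below d b >].
by apply: asbool_equiv_eq; split; apply: below_trans.
Qed.

Lemma count_runs_absorb b c d o : below c d ->
  count_runs b d (count_runs b c o) = count_runs b c o /\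
  count_runs b c (count_runs b d o) = count_runs b c o.
Proof.
move=> cd; case: o => [[t n]|//]; rewrite /count_runs.
have up : `[< below b c >] -> `[< below b d >].
  by move/asboolP => bc; apply/asboolP; apply: below_trans cd.
have down : `[< below d b >] -> `[< below c b >].
  by move/asboolP => db; apply/asboolP; apply: below_trans db.
move: up down.
case: `[< below b c >] => [/(_ isT) ->|_];
  case: `[< below d b >] => [/(_ isT) ->|_].
- by rewrite /enter_run; case: t.
- by rewrite /enter_run; case: `[< below c b >]; case: t.
- by case: `[< below b d >].
- by rewrite /enter_run; case: `[< below c b >]; case: `[< below b d >]; case: t.
Qed.

Lemma count_runs_letter b d t n : (below d b -> below b d) ->
  exists t' n', [/\ count_runs b d (Some (t, n)) = Some (t', n'), n <= n' &
    n = n' -> [/\ t = t', same_class b d -> t = true & ~ below b d -> t = false]].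
Proof.
rewrite /count_runs /enter_run => hd.
have [bd|nbd] := asboolP (below b d).
  have [db|ndb] := asboolP (below d b).
    by case: t; [exists true, n | exists true, n.+1]; split=> //= /n_Sn.
  by exists t, n; split=> // _; split=> // -[].
rewrite asboolF; last by move/hd.
case: t; [exists false, n.+1 | exists false, n]; split=> //=; first by move/n_Sn.
by split=> // -[].
Qed.

Lemma count_runs_foldl b (s : seq S) t n :
  (forall d, d \in s -> below d b -> below b d) ->
  exists t' n', [/\
    foldl (fun o d => count_runs b d o) (Some (t, n)) s = Some (t', n'),
    n <= n' & n = n' -> t = t' /\ forall d, d \in s ->
      (same_class b d -> t = true) /\ (~ below b d -> t = false)].
Proof.
elim: s t n => [|c s IH] t n hs; first by exists t, n; split.
have [t1 [n1 [e1 le1 eq1]]] := count_runs_letter t n (hs c (mem_head _ _)).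
have [|t2 [n2 [e2 le2 eq2]]] := IH t1 n1.
  by move=> d ds; apply: hs; rewrite inE ds orbT.
exists t2, n2; split=> /=; [by rewrite e1 | exact: leq_trans le1 le2 |].
move=> n02; have n01 : n = n1.
  by apply/eqP; rewrite eqn_leq le1 n02 le2.
have [t01 h1 h2] := eq1 n01; have [t12 h] := eq2 (etrans (esym n01) n02).
split; first exact: etrans t12.
by move=> d; rewrite inE => /orP[/eqP -> //|/h]; rewrite t01.
Qed.

(** Let b be minimal among the letters of x.  If x has a letter not above b,
    then reading x always increases the number of runs, so x x and x have
    different effects.  Hence all letters are above b, and the letter b absorbs
    them into its class. *)
Lemma idempotent_core x : x * x = x -> exists b, core b x.
Proof.
have [w {x}->] := ig_word x; set x := word_eval i w => xx.
have [b bw hb] := minimal_letter w.1 w.2; exists b; apply: core_word => // d dw.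
apply: contrapT => nbd.
case: hi => _ _.
case/(_ _ (count_runs b)) => [c e o /(basic_pair_class hS) h|run [run_i run_mul]].
  by case: h => -[ce /count_runs_class <-]; have [] := count_runs_absorb b o ce.
have run_w o : run x o = foldl (fun o d => count_runs b d o) o (w.1 :: w.2).
  rewrite /x; case: (w) => a s; rewrite /word_eval /=.
  elim/last_ind: s => [|s e IH]; first by rewrite run_i.
  by rewrite -!cats1 !foldl_cat /= run_mul IH run_i.
have [t1 [n1 [e1 le1 _]]] := count_runs_foldl true 0 hb.
have [t2 [n2 [e2 le2 eq2]]] := count_runs_foldl t1 n1 hb.
have := run_mul x x (Some (true, 0)); rewrite xx !run_w e1 e2 => -[_ n12].
have [_ h] := eq2 n12.
have := (h b bw).1 (same_class_refl hS b); rewrite ((h d dw).2 nbd) //.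
Qed.

Lemma core_proj b x (proj : T -> S) : (forall d, proj (i d) = d) ->
  (forall x y, proj (x * y) = proj x * proj y) ->
  core b x -> same_class b (proj x).
Proof.
move=> pi pM; elim=> [d|y z _ ? _ ?]; rewrite ?pi ?pM //.
exact: same_class_mul.
Qed.

(** * Maximal subgroups of IG of a band *)

Definition mult_of (G K : magmaType) (f : G -> K)
    (fM : {morph f : x y / x * y}) : {multiplicative G -> K} :=
  HB.pack f (isMultiplicative.Build G K f fM).

Section Structure.
Variables (proj : T -> S).
Hypotheses (proj_i : forall d, proj (i d) = d).
Hypothesis projM : forall x y, proj (x * y) = proj x * proj y.

(** The row of the first letter of x is the row of the image of x in S, and
    q lies in this row. *)
Lemma core_unit_l b x q : core b x -> same_class b q ->
  q * proj x = proj x -> i q * x = x.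
Proof.
move=> + bq; elim=> [d bd|y z cy IH cz _].
  by rewrite proj_i => qd; rewrite ig_mul qd //; apply: Or42.
rewrite projM mulgA => h; rewrite mulgA IH //.
have yzy : proj y * proj z * proj y = proj y.
  by apply: (class_below hS (core_proj proj_i projM cy));
    case: (core_proj proj_i projM cz).
by rewrite -{1}yzy !mulgA h yzy.
Qed.

Lemma core_unit_r b x q : core b x -> same_class b q ->
  proj x * q = proj x -> x * i q = x.
Proof.
move=> + bq; elim=> [d bd|y z cy _ cz IH].
  by rewrite proj_i => qd; rewrite ig_mul qd //; apply: Or41.
rewrite projM => h; rewrite -mulgA IH //.
have zyz : proj z * proj y * proj z = proj z.
  by apply: (class_below hS (core_proj proj_i projM cz));
    case: (core_proj proj_i projM cy).
by rewrite -{1}zyz -!mulgA (mulgA _ _ q) h mulgA zyz.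
Qed.

(** The elements that are products of letters of one class form a completely
    simple semigroup: all of them lie in subgroups.  If y1 and y2 invert x1 and
    x2, with images p and r, then [r p] bridges y2 and y1. *)
Lemma core_inverse b x : core b x -> exists y,
  [/\ core b y, proj y = proj x, x * y = i (proj x) & y * x = i (proj x)].
Proof.
elim=> [d bd|x1 x2 c1 [y1 [cy1 p1 xy1 yx1]] c2 [y2 [cy2 p2 xy2 yx2]]].
  by exists (i d); rewrite !ig_idem proj_i; split=> //; apply: generated_i.
have bp := core_proj proj_i projM c1; have br := core_proj proj_i projM c2.
rewrite projM; set p := proj x1 in p1 xy1 yx1 bp *.
set r := proj x2 in p2 xy2 yx2 br *.
have bpr := same_class_mul hS bp br; have brp := same_class_mul hS br bp.
have ci d : same_class b d -> core b (i d) by apply: generated_i.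
have rect := rectangular hS.
exists (i (p * r) * y2 * i (r * p) * y1 * i (p * r)); split.
- by do ![apply: generated_mul => //; try exact: ci].
- rewrite !projM !proj_i p1 p2 -/p -/r !mulgA.
  by rewrite !(band_idem_r hS) (band_idem2 hS).
- have e1 : x2 * i (p * r) = x2.
    by apply: core_unit_r c2 bpr _; rewrite mulgA (rect b).
  have e2 : i r * i (r * p) = i (r * p) by rewrite ig_mul mulgA hS //; apply: Or42.
  have e3 : x1 * i (r * p) = x1.
    by apply: core_unit_r c1 brp _; rewrite mulgA (rect b).
  have e4 : i p * i (p * r) = i (p * r) by rewrite ig_mul mulgA hS //; apply: Or42.
  by rewrite !mulgA -(mulgA x1 x2) e1 -(mulgA x1 x2) xy2 -(mulgA x1) e2 e3 xy1 e4.
- have e1 : i (p * r) * x1 = x1 by apply: core_unit_l c1 bpr _; rewrite (rect b).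
  have e2 : i (r * p) * i p = i (r * p) by rewrite ig_mul -mulgA hS //; apply: Or41.
  have e3 : i (r * p) * x2 = x2 by apply: core_unit_l c2 brp _; rewrite (rect b).
  have e4 : i (p * r) * i r = i (p * r) by rewrite ig_mul -mulgA hS //; apply: Or41.
  rewrite -!mulgA (mulgA (i (p * r)) x1) e1 (mulgA y1) yx1 (mulgA (i (r * p))) e2.
  by rewrite e3 yx2 e4.
Qed.

Lemma generated_sub (P Q : S -> Prop) x :
  (forall d, P d -> Q d) -> generated P x -> generated Q x.
Proof.
move=> PQ; elim=> [d /PQ|y z _ ? _ ?]; first exact: generated_i.
exact: generated_mul.
Qed.

Lemma generated_proj x : generated (below (proj x)) x.
Proof.
case: hi => _ ind _; apply: (ind (fun x => generated (below (proj x)) x)).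
  by move=> d; apply: generated_i; rewrite proj_i; apply: below_refl.
move=> y z gy gz; rewrite projM; apply: generated_mul.
  by apply: generated_sub gy => d; apply: below_trans => //; apply: below_mulrl.
by apply: generated_sub gz => d; apply: below_trans => //; apply: below_mulrr.
Qed.

(** The H-class of the letter [i e]. *)
Definition core_group e : set T := [set x | core e x /\ proj x = e].

Lemma core_group_i e : core_group e (i e).
Proof.
by split; rewrite ?proj_i //; apply: generated_i; apply: same_class_refl.
Qed.

Lemma core_group_unit e x : core_group e x -> i e * x = x /\ x * i e = x.
Proof.
move=> [cx px]; have ee := same_class_refl hS e.
by split; [apply: core_unit_l cx ee _ | apply: core_unit_r cx ee _];
  rewrite px hS.
Qed.

Lemma core_group_subgroup e : subgroup (core_group e).
Proof.
split=> [x y [cx px] [cy py]|].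
  by split; [apply: generated_mul | rewrite projM px py hS].
exists (i e); split=> [|x|x [cx px]].
- exact: core_group_i.
- exact: core_group_unit.
- have [y [cy py xy yx]] := core_inverse cx.
  by exists y; rewrite xy yx /core_group /= py px.
Qed.

(** The identity u of H is idempotent, so it is a product of letters of one
    class, and an idempotent in a subgroup with identity [proj u] is equal to
    this identity.  Any x in H is u x, and u absorbs the letters of x, which are
    all above the class of u. *)
Lemma maximal_subgroup_core H : maximal_subgroup H -> exists e, H = core_group e.
Proof.
move=> [[Hmul [u [Hu uH Hinv]]] Hmax]; exists (proj u).
apply/esym/Hmax; first exact: core_group_subgroup.
have uu : u * u = u by case: (uH _ Hu).
have [b cbu] := idempotent_core uu.
have cu : core (proj u) u.
  have bu := core_proj proj_i projM cbu.
  apply: generated_sub cbu => d.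
  exact: (same_class_trans hS (same_class_sym bu)).
have pu : u = i (proj u).
  have [y [_ _ uy _]] := core_inverse cu.
  have pp : u * i (proj u) = u.
    by apply: core_unit_r cu (same_class_refl hS _) _; rewrite hS.
  by rewrite -{1}pp -uy mulgA uu uy.
move=> x Hx; have [ux xu] := uH _ Hx; have [y [Hy xy yx]] := Hinv _ Hx.
have px : proj x = proj u.
  have : proj x * proj u = proj x by rewrite -projM xu.
  by rewrite -xy projM mulgA hS.
split=> //; rewrite -ux; apply: (core_mul_above cu _).1.
by rewrite -px; apply: generated_proj.
Qed.

(** * Freeness over right seminormal bands *)

Section RightSeminormal.
Hypothesis hR : forall t u v : S, t * u * v = t * v * t * u * v.
Variable e : S.

Definition in_row m : Prop := e * m = m /\ m * e = e.
Definition in_col n : Prop := n * e = n /\ e * n = e.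

Lemma in_row_class m : in_row m -> same_class e m.
Proof. by move=> [em me]; split; rewrite /below ?em ?me ?em. Qed.

Lemma in_col_class n : in_col n -> same_class e n.
Proof. by move=> [ne en]; split; rewrite /below ?ne ?en ?hS. Qed.

Lemma in_row_act m c : in_row m -> below e c -> in_row (m * c).
Proof.
move=> rm ec; have [em me] := rm; split; first by rewrite mulgA em.
have [+ _] := same_class_absorb_r hS (in_row_class rm) ec.
by rewrite /below mulgA em.
Qed.

Lemma in_col_act c : below e c -> in_col (c * e).
Proof. by move=> ec; split; rewrite ?band_idem_r // mulgA ec. Qed.

(** The identity c x y = c y c x y says that c x y lies in the row of c y. *)
Lemma row_constant c x y : below e c -> below e x -> same_class e y ->
  c * x * y = c * y.
Proof.
move=> ec ex ey.
have cls : same_class e (c * x * y).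
  by apply: same_class_absorb_l => //; apply: below_mul.
have -> : c * x * y = c * y * (c * x * y) * y.
  by rewrite !mulgA band_idem_r -?hR.
rewrite (rectangular hS _ cls ey) ?band_idem_r //.
exact: same_class_absorb_l.
Qed.

(** With [n] = [n m2][n], the element c slides through the product:
    [m1][n m2] = [m1][c][n m2] = [m1][c n m2] = [m1][c m2] = [m1][c][m2]
    = [m1][m2] = [m2], where c n m2 = c m2 by right seminormality. *)
Lemma column_identified c m1 m2 n : below e c -> in_row m1 -> in_row m2 ->
  m1 * c = m1 -> m2 * c = m2 -> in_col n -> i m1 * i n = i m2 * i n.
Proof.
move=> ec r1 r2 m1c m2c ln.
have en := in_col_class ln; have em2 := in_row_class r2.
have nm2n : n * m2 * n = n by apply: (class_below hS en); case: em2.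
have nE : i n = i (n * m2) * i n by rewrite ig_mul nm2n //; apply: Or42.
rewrite [in LHS]nE.
rewrite mulgA; congr (_ * _).
have m1E : i m1 = i m1 * i c by rewrite ig_mul m1c //; apply: Or41.
rewrite [in LHS]m1E.
rewrite -mulgA ig_mul; last by apply: Or44; rewrite -mulgA m2c.
rewrite mulgA row_constant //; last by case: en.
rewrite -ig_mul; last by apply: Or44.
rewrite mulgA ig_mul ?m1c; last by apply: Or41.
have m12 : m1 * m2 = m2 by have [em2' _] := r2; rewrite -em2' mulgA r1.2.
by rewrite ig_mul m12 //; apply: Or42.
Qed.

Lemma in_row_e : in_row e. Proof. by split; rewrite hS. Qed.

Lemma sandwich_core_group m n :
  in_row m -> in_col n -> core_group e (i m * i n).
Proof.
move=> rm cn; split.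
  by apply: generated_mul; apply: generated_i;
    [apply: in_row_class | apply: in_col_class].
have [+ _] := same_class_mul hS (in_row_class rm) (in_col_class cn).
by rewrite /below projM !proj_i !mulgA rm.1 -(mulgA m) cn.1.
Qed.

Section Extension.
Variables (K : groupType) (F : T -> K).
Hypothesis F1 : F (i e) = 1.

Let p m n : K := F (i m * i n).

(** The right regular action of the Rees matrix semigroup over K with sandwich
    matrix [p], on one row: the letter (i, l) multiplies (m, k) by the element
    (i, p(l, i)^-1, l).  A letter d above the class of e acts as the element
    with row [d * e] that sends the column [m] to [m * d]; the other letters
    act as zero. *)
Definition rees_act d (o : option (S * K)) : option (S * K) :=
  if o is Some (m, k) then
    if `[< below e d /\ in_row m >]
    then Some (m * d, k * p m (d * e) * (p (m * d) (d * e))^-1) else None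
  else None.

Lemma rees_act_mul c d o : basic_pair c d ->
  rees_act (c * d) o = rees_act d (rees_act c o).
Proof.
case: o => [[m k]|//] cd; rewrite /rees_act.
have [[ecd rm]|n] := asboolP (below e (c * d) /\ in_row m); last first.
  have [[ec rm]|//] := asboolP (below e c /\ in_row m).
  rewrite asboolF // => -[ed _]; apply: n; split=> //; exact: below_mul.
have ec := below_mull hS ecd; have ed := below_mulr hS ecd.
have rmc := in_row_act rm ec; have rmcd := in_row_act rmc ed.
rewrite asboolT // asboolT // mulgA row_constant //; last exact: same_class_refl.
congr (Some (_, _)); rewrite -!(mulgA (k * p m (c * e))); congr (_ * _).
have cls := same_class_refl hS e.
(* only in the last case are the two columns different from each other; both
   are fixed by c *)
case/basic_pairP: cd => h.
- by rewrite -(mulgA m) h mulgK.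
- by rewrite -(row_constant ec ed cls) h mulVg mul1g.
- by rewrite -(row_constant ed ec cls) h mulVg mul1g.
have rmcc : m * c * c = m * c by rewrite -mulgA hS.
have rmcdc : m * c * d * c = m * c * d by rewrite -mulgA h.
rewrite /p -(column_identified ec rmc rmcd rmcc rmcdc (in_col_act ed)).
rewrite -(column_identified ec rmc rmcd rmcc rmcdc (in_col_act ec)).
by rewrite mulgK.
Qed.

Definition shift (h : K) (o : option (S * K)) :=
  omap (fun q : S * K => (q.1, h * q.2)) o.

Lemma rees_act_shift h d o : rees_act d (shift h o) = shift h (rees_act d o).
Proof. by case: o => [[m k]|//] /=; case: asbool => //=; rewrite !mulgA. Qed.

(** [phi x] is the K-component of the result of letting [x] act on (e, 1); it is
    multiplicative because the action commutes with left multiplications by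
    elements of K. *)
Lemma extension_exists : exists phi : T -> K,
  [/\ forall x y, core_group e x -> core_group e y ->
        phi (x * y) = phi x * phi y &
      forall m n, in_row m -> in_col n -> phi (i m * i n) = F (i m * i n)].
Proof.
case: hi => _ ind /(_ _ rees_act rees_act_mul) [run [run_i run_mul]].
have run_shift x h o : run x (shift h o) = shift h (run x o).
  apply: (ind (fun x => forall o, run x (shift h o) = shift h (run x o))).
    by move=> d o'; rewrite !run_i rees_act_shift.
  by move=> y z IHy IHz o'; rewrite !run_mul IHy IHz.
have run_core x m h : core e x -> in_row m ->
    exists k, run x (Some (m, h)) = Some (m * proj x, k).
  move=> cx; elim: x / cx m h => [d ed|y z cy IHy cz IHz] m h rm.
    by rewrite run_i /= proj_i asboolT; [eexists | split=> //; case: ed].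
  have [k1 e1] := IHy m h rm.
  have [|k2 e2] := IHz (m * proj y) k1.
    by apply: in_row_act => //; case: (core_proj proj_i projM cy).
  by exists k2; rewrite run_mul e1 e2 projM mulgA.
pose phi x : K := if run x (Some (e, 1)) is Some q then q.2 else 1.
have phiP x k : core_group e x -> run x (Some (e, k)) = Some (e, k * phi x).
  move=> [cx px]; have := run_shift x k (Some (e, 1)); rewrite /= mulg1 => ->.
  have [h hh] := run_core x e 1 cx in_row_e.
  by rewrite /phi hh /= px hS.
exists phi; split=> [x y gx gy|m n rm cn].
  have gxy := (core_group_subgroup e).1 _ _ gx gy.
  have := phiP _ 1 gxy; rewrite run_mul !phiP // !mul1g.
  by move=> [->].
have := phiP _ 1 (sandwich_core_group rm cn).
rewrite run_mul !run_i /= asboolT; last first.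
  by split; [case: (in_row_class rm) | apply: in_row_e].
rewrite /= asboolT; last first.
  by split; [case: (in_col_class cn) | rewrite rm.1].
rewrite !mul1g => -[_ <-].
rewrite rm.1 rm.2 cn.1 /p.
have ex : i e * i e = i e by rewrite ig_idem.
have mx : i m * i e = i e by rewrite ig_mul rm.2 //; apply: Or42.
have xn : i e * i n = i e by rewrite ig_mul cn.2 //; apply: Or41.
have -> : m * n = e.
  by have [_] := sandwich_core_group rm cn; rewrite projM !proj_i.
by rewrite ex mx xn !F1 !mul1g invg1 mul1g mulg1.
Qed.

End Extension.

(** Distinct pairs (m, n) may give the same sandwich entry, and some entries are
    trivial.  Taking as basis the set of nontrivial values, and prescribing the
    entries through their values, makes the relations between entries hold
    automatically. *)
Lemma core_group_free : free_group (subgroup_group (core_group_subgroup e)).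
Proof.
set hG := core_group_subgroup e; pose G : groupType := subgroup_group hG.
pose sv : G -> T := @sgval _ _ hG.
have sv1 : sv 1 = i e by apply: sgval1; [exact: core_group_i | rewrite ig_idem].
exists [set g : G | g <> 1 /\
  exists m n, [/\ in_row m, in_col n & sv g = i m * i n]].
move=> K f; split.
  pose F t : K := if pselect (core_group e t) is left h then
    let g : G := sgmk hG h in if g == 1 then 1 else f g else 1.
  have FE (g : G) : F (sv g) = if g == 1 then 1 else f g.
    rewrite /F; case: pselect => [h|]; last by case; apply: sgvalP.
    have -> // : sgmk hG h = g.
    exact: sgval_inj.
  have F1 : F (i e) = 1.
    by rewrite -sv1 FE eqxx.
  have [phi [phiM phiE]] := extension_exists F1.
  have phi'M : {morph (fun g : G => phi (sv g)) : x y / x * y}.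
    by move=> x y; rewrite -phiM //; apply: sgvalP.
  exists (mult_of phi'M) => g [g1 [m [n [rm cn gE]]]] /=.
  by rewrite gE phiE // -gE FE; case: eqP.
move=> phi psi hphi hpsi.
have agree1 : phi 1 = psi 1 by rewrite !multiplicative1.
have agree_sandwich m n g : in_row m -> in_col n -> sv g = i m * i n ->
    phi g = psi g.
  move=> rm cn gE; have [->//|g1] := pselect (g = 1).
  by rewrite hphi ?hpsi //; split=> //; exists m, n.
(* the sandwich entries generate: [e][d][e] is the inverse of the entry
   [e d][d e], and [e] y z [e] splits as ([e] y [e]) [e p][r e] ([e] z [e]) *)
have agree_core x : core e x -> forall g, sv g = i e * x * i e -> phi g = psi g.
  have ce : core e (i e) by case: (core_group_i e).
  elim=> {x} [d ed|y z cy IHy cz IHz] g gE.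
    have be : below e d by case: ed.
    have rm := in_row_act in_row_e be; have cn := in_col_act be.
    pose h : G := sgmk hG (sandwich_core_group rm cn).
    have hg : h * g = 1.
      apply: sgval_inj; rewrite -/(sv 1) sv1.
      have -> : sgval (h * g) = i (e * d) * i (d * e) * (i e * i d * i e).
        by rewrite -gE.
      have e1 : i (d * e) * i e = i (d * e) by rewrite ig_mul cn.1 //; apply: Or41.
      have e2 : i (d * e) * i d = i d.
        have ded : d * e * d = d by case: ed.
        by rewrite ig_mul ded //; apply: Or42.
      have e3 : i (e * d) * i d = i (e * d).
        by rewrite ig_mul -mulgA hS //; apply: Or41.
      have e4 : i (e * d) * i e = i e by rewrite ig_mul rm.2 //; apply: Or42.
      by rewrite !mulgA -(mulgA (i (e * d))) e1 -(mulgA (i (e * d))) e2 e3 e4.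
    have -> : g = h^-1 by rewrite (mulg1_eq hg).
    by rewrite !multiplicativeV (agree_sandwich _ _ h rm cn).
  have core_e x : core e x -> core_group e (i e * x * i e).
    move=> cx; split; first by do ![apply: generated_mul => //].
    by rewrite !projM !proj_i; case: (core_proj proj_i projM cx).
  have rm := in_row_act in_row_e (core_proj proj_i projM cy).1.
  have cn := in_col_act (core_proj proj_i projM cz).1.
  pose h : G := sgmk hG (sandwich_core_group rm cn).
  pose gy : G := sgmk hG (core_e y cy); pose gz : G := sgmk hG (core_e z cz).
  have -> : g = gy * h * gz.
    apply: sgval_inj; rewrite -/(sv g) gE.
    set p := proj y; set r := proj z.
    have ep : same_class e p by apply: core_proj proj_i projM cy.
    have er : same_class e r by apply: core_proj proj_i projM cz.
    have -> : sgval (gy * h * gz) =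
      i e * y * i e * (i (e * p) * i (r * e)) * (i e * z * i e) by [].
    have e1 : i e * i (e * p) = i (e * p).
      by rewrite ig_mul mulgA hS //; apply: Or42.
    have e2 : i (r * e) * i e = i (r * e).
      by rewrite ig_mul -mulgA hS //; apply: Or41.
    have e3 : y * i (e * p) = y.
      apply: (core_unit_r cy (same_class_mul hS (same_class_refl hS e) ep)).
      by rewrite mulgA; case: ep.
    have e4 : i (r * e) * z = z.
      apply: (core_unit_l cz (same_class_mul hS er (same_class_refl hS e))).
      by case: er.
    rewrite !mulgA -[in RHS](mulgA (i e * y)) e1 -[in RHS](mulgA (i e)) e3.
    by rewrite -[in RHS](mulgA (i e * y)) e2 -[in RHS](mulgA (i e * y)) e4.
  by rewrite !gmulfM (IHy gy) // (IHz gz) // (agree_sandwich _ _ h rm cn).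
move=> g; apply: (agree_core (sv g)); first by case: (sgvalP g).
by have [-> ->] := core_group_unit (sgvalP g).
Qed.

End RightSeminormal.
End Structure.

Lemma right_seminormal_free
    (hR : forall t u v : S, t * u * v = t * v * t * u * v) (H : set T) :
  maximal_subgroup H -> is_free_group H.
Proof.
have [proj [proj_i projM]] := ig_proj.
move=> /(maximal_subgroup_core proj_i projM)[e ->].
exact: free_subgroup (core_group_free proj_i projM hR e).
Qed.

End IGLike.

(** * The free idempotent generated semigroup and its dual *)

Section Presentation.
Variables (S : semigroupType) (hS : band S).

Definition band_idempotent (d : S) : idempotents S := exist _ d (introT eqP (hS d)).

Definition ig_letter (d : S) : IG S :=
  \pi_(quot_semigroup (@IG_rel S)) (letter (band_idempotent d)).

Lemma ig_like_IG : ig_like ig_letter.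
Proof.
split=> [c d cd|P Pi PM x|St act actM].
- rewrite /ig_letter; apply/esym.
  apply: etrans (quot_mul_pi _ _ _) _; apply/quot_semigroupP.
  apply: CongIn; exists (band_idempotent c), (band_idempotent d).
  by exists (band_idempotent (c * d)); split.
- have valK a : band_idempotent (val a) = a by apply: val_inj.
  rewrite -(reprK x); case: (repr x) => a s; elim/last_ind: s => [|s b IH].
    by have := Pi (val a); rewrite /ig_letter valK.
  have := PM _ _ IH (Pi (val b)); rewrite /ig_letter valK.
  by rewrite [X in P X](quot_mul_pi _ _ _) /mul /= /word_mul /= cats1.
pose fold (w : word (idempotents S)) s :=
  foldl (fun s a => act (val a) s) s (w.1 :: w.2).
have foldM u v s : fold (u * v) s = fold v (fold u s).
  by case: u v => [a u] [b v]; rewrite /fold /= foldl_cat.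
have fold_cong u v : congruence_closure (@IG_rel S) u v -> fold u = fold v.
  elim=> {u v} [u v [c [d [g [cd gE -> ->]]]]|//|u v _ -> //|v u w _ -> _ -> //|].
    by apply/funext => s; rewrite /fold /= gE actM.
  by move=> u u' v v' _ eu _ ev; apply/funext => s; rewrite !foldM eu ev.
exists (fun x => fold (repr x)); split=> [d s|x y s].
  have -> // : fold (repr (ig_letter d)) = fold (letter (band_idempotent d)).
  by apply: fold_cong; apply/quot_semigroupP; rewrite reprK.
have -> : fold (repr (x * y)) = fold (repr x * repr y).
  by apply: fold_cong; apply/quot_semigroupP; rewrite reprK.
exact: foldM.
Qed.

End Presentation.

Definition opposite (S : Type) : Type := S.
HB.instance Definition _ (S : choiceType) := Choice.copy (opposite S) S.

Section Opposite.
Variable S : semigroupType.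

Definition opp_mul (x y : opposite S) : opposite S := (y : S) * (x : S).
Fact opp_mulA : associative opp_mul.
Proof. by move=> x y z; rewrite /opp_mul mulgA. Qed.
HB.instance Definition _ := isSemigroup.Build (opposite S) opp_mulA.

Lemma opp_subgroup (H : set S) :
  subgroup H <-> subgroup (H : set (opposite S)).
Proof.
split=> -[HM [e [He eH Hinv]]]; (split=> [x y Hx Hy|]; first exact: HM);
  (exists e; split=> // [x /eH[]//|x /Hinv[y [Hy xy yx]]]; by exists y).
Qed.

Lemma opp_maximal_subgroup (H : set S) :
  maximal_subgroup H -> maximal_subgroup (H : set (opposite S)).
Proof.
move=> [/opp_subgroup sH Hmax]; split=> // K /opp_subgroup sK.
exact: Hmax.
Qed.

(** Composing with the inversion turns a homomorphism into an antihomomorphism.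
    *)
Lemma opp_free_subgroup (H : set S) :
  is_free_group (H : set (opposite S)) -> is_free_group H.
Proof.
move=> [G [f [fG finj frange]]].
have gM : {morph (fun x : G => f x^-1 : S) : x y / x * y}.
  by move=> x y; rewrite invgM gmulfM.
exists G, (mult_of gM); split=> //.
  by move=> x y /finj/invg_inj.
rewrite -frange; apply/seteqP; split=> _ [x _ <-]; exists x^-1 => //=.
by rewrite invgK.
Qed.

End Opposite.

(** A right action on St is a left action on the maps from St to St. *)
Lemma opp_ig_like (S T : semigroupType) (i : S -> T) :
  ig_like i -> @ig_like (opposite S) (opposite T) i.
Proof.
have opp_basic (c d : S) : @basic_pair (opposite S) c d <-> basic_pair d c.
  by split=> -[x [h1 h2]]; exists x; split=> //; case: h2 => ->;
    [right | left | right | left].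
move=> [ib ind ex]; split=> [c d /opp_basic cd|P Pi PM|St act actM].
- exact: ib.
- by apply: ind => // x y Px Py; apply: PM.
have [|run [run_i run_mul]] := ex (St -> St) (fun d h s => h (act d s)).
  move=> c d h cd; apply/funext => s; congr h; apply: actM.
  exact/opp_basic.
exists (fun x s => run x id s); split=> [d s|x y s]; first by rewrite run_i.
have runE z : forall h s', run z h s' = h (run z id s').
  apply: (ind (fun z => forall h s', run z h s' = h (run z id s'))) =>
    [d h s'|u v IHu IHv h s'].
    by rewrite !run_i.
  by rewrite !run_mul IHv IHu [in RHS]IHv.
by rewrite -[LHS]/(run ((y : T) * (x : T)) id s) run_mul runE.
Qed.

Lemma LSNB_opposite S : LSNB S -> RSNB (opposite S).
Proof.
move=> [hS hL]; have hL' (t u v : S) : v * (u * t) = v * (u * (t * (v * t))).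
  by rewrite !mulgA.
split=> [x|t u v]; [exact: hS | exact: hL'].
Qed.

Lemma RSNB_free S (H : set (IG S)) :
  RSNB S -> maximal_subgroup H -> is_free_group H.
Proof. by move=> [hS hR]; apply: right_seminormal_free (ig_like_IG hS) hR _. Qed.

Lemma LSNB_free S (H : set (IG S)) :
  LSNB S -> maximal_subgroup H -> is_free_group H.
Proof.
move=> hL /opp_maximal_subgroup Hmax; have [hS hR] := LSNB_opposite hL.
apply: opp_free_subgroup; apply: right_seminormal_free hS _ hR _ Hmax.
exact: opp_ig_like (ig_like_IG hL.1).
Qed.

(** * Varieties contained neither in LSNB nor in RSNB *)

Lemma word_eval_rcons (A : choiceType) (S : semigroupType) (s : A -> S) a l b :
  word_eval s (a, rcons l b) = word_eval s (a, l) * s b.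
Proof. by rewrite /word_eval /= -cats1 foldl_cat. Qed.

Lemma word_eval_morph (A : choiceType) (S S' : semigroupType) (f : S -> S')
    (fM : {morph f : x y / x * y}) (s : A -> S) w :
  f (word_eval s w) = word_eval (f \o s) w.
Proof.
by case: w => a l; elim/last_ind: l => [//|l b IH]; rewrite !word_eval_rcons fM IH.
Qed.

Lemma word_reversal (A : choiceType) (w : word A) :
  exists w', forall (S : semigroupType) (s : A -> S),
    @word_eval A (opposite S) s w = word_eval s w'.
Proof.
case: w => a l; elim/last_ind: l => [|l b [w IH]]; first by exists (letter a).
exists (word_mul (letter b) w) => S s.
by rewrite word_eval_mul -IH word_eval_rcons.
Qed.

(** The two-element right zero band with an identity [None] adjoined. *)
Definition right_zero1 : Type := option bool.
HB.instance Definition _ := Choice.on right_zero1.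
Definition right_zero1_mul (x y : right_zero1) : right_zero1 :=
  if y is Some _ then y else x.
Fact right_zero1_mulA : associative right_zero1_mul.
Proof. by move=> x y [b|]. Qed.
HB.instance Definition _ := isSemigroup.Build right_zero1 right_zero1_mulA.

(** In S take X = t A t and Y = t C t, for which t is an identity.  The elements
    X Y and X Y X are transformed by right multiplication by t, X and Y just as the
    two right zeros are by the three elements of the small band.  So an identity
    that fails there gives X Y = X Y X in S, and A = v, C = v u yields the
    identity of LSNB. *)
Lemma satisfies_right_zero1 (S : semigroupType) I :
  band S -> ~ LSNB S -> satisfies S I -> satisfies right_zero1 I.
Proof.
move=> hS nL hI s; apply: contrapT => ne; apply: nL; split=> // t u v.
have key A C : t * A * t * C * t = t * A * t * C * t * A * t.
  pose X := t * A * t; pose Y := t * C * t.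
  pose W (b : bool) := if b then X * Y * X else X * Y.
  pose sigma n := if s n is Some b then (if b then X else Y) else t.
  have Wsigma b n : W b * sigma n = W (odflt b (s n)).
    rewrite /W /sigma; case: (s n) => [[]|] /=; case: b.
    - by rewrite band_idem_r.
    - by [].
    - by rewrite -mulgA hS.
    - by rewrite band_idem_r.
    - by rewrite [in LHS]/X !mulgA band_idem_r // -!mulgA.
    - by rewrite [in LHS]/Y !mulgA band_idem_r // -!mulgA.
  have Weval b w : W b * word_eval sigma w = W (odflt b (word_eval s w)).
    case: w => a l; elim/last_ind: l => [|l c IH]; first exact: Wsigma.
    rewrite !word_eval_rcons mulgA IH Wsigma /mul /= /right_zero1_mul.
    by case: (s c).
  have WW : W true = W false.
    have [b nb] : exists b,
        odflt b (word_eval s I.1) != odflt b (word_eval s I.2).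
      move: ne; case: (word_eval s I.1) (word_eval s I.2) => [[]|] [[]|] ne //;
       by [exists true | exists false].
    have := Weval b I.1; rewrite hI Weval.
    by move: nb; case: (odflt b _); case: (odflt b _).
  by move: WW; rewrite /W /X /Y !mulgA !(band_idem_r hS) => ->.
have k2 := key v (v * u); rewrite !mulgA in k2.
have tv : t * v * t * v * u * t = t * v * u * t by rewrite band_idem2.
rewrite tv in k2.
rewrite -[LHS]hS !mulgA.
have -> : v * u * t * v * u * t = v * u * (t * v * u * t) by rewrite !mulgA.
rewrite k2 !mulgA.
by have := hS (v * u * t); rewrite !mulgA => ->.
Qed.

Lemma satisfies_opposite_right_zero1 (S : semigroupType) I :
  band S -> ~ RSNB S -> satisfies S I -> satisfies (opposite right_zero1) I.
Proof.
move=> hS nR hI s; case: I hI => p q hI.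
have [p' hp] := word_reversal p; have [q' hq] := word_reversal q.
rewrite /= hp hq; apply: (@satisfies_right_zero1 (opposite S) (p', q') hS).
  move=> [_ h]; apply: nR; split=> [|t u v]; first exact: hS.
  have huv : t * (u * v) = t * (v * (t * (u * v))) := h t u v.
  by rewrite -mulgA huv !mulgA.
by move=> r /=; rewrite -hp -hq; apply: hI.
Qed.

(** The 2 x 2 rectangular band times the 2 x 2 rectangular band with an
    identity [None] adjoined. *)
Definition torus_band : Type := ((bool * bool) * option (bool * bool))%type.
HB.instance Definition _ := Choice.on torus_band.

Definition torus_mul (c d : torus_band) : torus_band :=
  ((c.1.1, d.1.2),
   match c.2, d.2 with
   | Some s, Some r => Some (s.1, r.2)
   | Some s, None => Some s
   | None, o => o
   end).
Fact torus_mulA : associative torus_mul.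
Proof. by move=> [[? ?] [[? ?]|]] [[? ?] [[? ?]|]] [[? ?] [[? ?]|]]. Qed.
HB.instance Definition _ := isSemigroup.Build torus_band torus_mulA.

Lemma torus_band_band : band torus_band.
Proof. by move=> [[? ?] [[? ?]|]]. Qed.

(** The four coordinates are homomorphisms to the small bands, and they separate
    the points. *)
Lemma satisfies_torus_band I : satisfies right_zero1 I ->
  satisfies (opposite right_zero1) I -> satisfies torus_band I.
Proof.
move=> hr hl s.
pose f1 (d : torus_band) : opposite right_zero1 := Some d.1.1.
pose f2 (d : torus_band) : right_zero1 := Some d.1.2.
pose f3 (d : torus_band) : opposite right_zero1 := omap fst d.2.
pose f4 (d : torus_band) : right_zero1 := omap snd d.2.
have m1 : {morph f1 : x y / x * y} by [].
have m2 : {morph f2 : x y / x * y} by [].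
have m3 : {morph f3 : x y / x * y} by move=> [? [[? ?]|]] [? [[? ?]|]].
have m4 : {morph f4 : x y / x * y} by move=> [? [[? ?]|]] [? [[? ?]|]].
have := hl (f1 \o s); rewrite -!(word_eval_morph m1).
have := hr (f2 \o s); rewrite -!(word_eval_morph m2).
have := hl (f3 \o s); rewrite -!(word_eval_morph m3).
have := hr (f4 \o s); rewrite -!(word_eval_morph m4).
case: (word_eval s I.1) (word_eval s I.2) =>
  [[? ?] [[? ?]|]] [[? ?] [[? ?]|]] //=.
  by move=> [->] [->] [->] [->].
by move=> _ _ [->] [->].
Qed.

Lemma torus_band_in_variety V (A B : semigroupType) : band_variety V ->
  V A -> ~ LSNB A -> V B -> ~ RSNB B -> V torus_band.
Proof.
move=> [Sigma hV] /hV[bA sA] nA /hV[bB sB] nB.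
apply/hV; split=> [|I SI]; first exact: torus_band_band.
apply: satisfies_torus_band.
  exact: satisfies_right_zero1 bA nA (sA _ SI).
exact: satisfies_opposite_right_zero1 bB nB (sB _ SI).
Qed.

(** * Commuting elements of a free group *)

(** Unitriangular 3 x 3 matrices over F_2; the third entry is the corner. *)
Definition heisenberg2 : Type := (bool * bool * bool)%type.
HB.instance Definition _ := Choice.on heisenberg2.

Definition heis_mul (x y : heisenberg2) : heisenberg2 :=
  (x.1.1 (+) y.1.1, x.1.2 (+) y.1.2, x.2 (+) y.2 (+) (x.1.1 && y.1.2)).
Definition heis_inv (x : heisenberg2) : heisenberg2 :=
  (x.1.1, x.1.2, x.2 (+) (x.1.1 && x.1.2)).
Definition heis_one : heisenberg2 := (false, false, false).

Fact heis_mulA : associative heis_mul.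
Proof. by do 3 case=> [[[] []] []]. Qed.
Fact heis_mul1 : left_id heis_one heis_mul.
Proof. by case=> [[[] []] []]. Qed.
Fact heis_1mul : right_id heis_one heis_mul.
Proof. by case=> [[[] []] []]. Qed.
Fact heis_mulV : left_inverse heis_one heis_inv heis_mul.
Proof. by case=> [[[] []] []]. Qed.
Fact heis_Vmul : right_inverse heis_one heis_inv heis_mul.
Proof. by case=> [[[] []] []]. Qed.
HB.instance Definition _ :=
  isGroup.Build heisenberg2 heis_mulA heis_mul1 heis_1mul heis_mulV heis_Vmul.

(** On a basis, map x to the matrix with entries [phi x] and [psi x] and corner
    0.  By uniqueness the two entries of the extension are [phi] and [psi]
    everywhere, so a and b are mapped to matrices that do not commute. *)
Lemma free_group_not_commute (G : groupType) (phi psi : G -> bool) (a b : G) :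
  {morph phi : x y / x * y >-> x (+) y} ->
  {morph psi : x y / x * y >-> x (+) y} ->
  free_group G -> phi a -> ~~ psi a -> ~~ phi b -> psi b -> a * b != b * a.
Proof.
move=> phiM psiM [X hX] pa qa pb qb; apply/eqP => ab.
have [[L LX] _] := hX heisenberg2 (fun x => (phi x, psi x, false)).
have emb1M : {morph (fun b => (b, false, false) : heisenberg2) :
    x y / x (+) y >-> x * y}.
  by move=> [] [].
have emb2M : {morph (fun b => (false, b, false) : heisenberg2) :
    x y / x (+) y >-> x * y}.
  by move=> [] [].
have L1 x : (L x).1.1 = phi x.
  have m1 : {morph (fun x => ((L x).1.1, false, false) : heisenberg2) :
      x y / x * y}.
    by move=> y z; rewrite -emb1M gmulfM.
  have m2 : {morph (fun x => (phi x, false, false) : heisenberg2) : x y / x * y}.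
    by move=> y z; rewrite -emb1M phiM.
  have [_ uniq] := hX heisenberg2 (fun x => (phi x, false, false)).
  have agree y : X y -> mult_of m1 y = (phi y, false, false) by move=> /LX /= ->.
  by have [] := uniq (mult_of m1) (mult_of m2) agree (fun _ _ => erefl) x.
have L2 x : (L x).1.2 = psi x.
  have m1 : {morph (fun x => (false, (L x).1.2, false) : heisenberg2) :
      x y / x * y}.
    by move=> y z; rewrite -emb2M gmulfM.
  have m2 : {morph (fun x => (false, psi x, false) : heisenberg2) : x y / x * y}.
    by move=> y z; rewrite -emb2M psiM.
  have [_ uniq] := hX heisenberg2 (fun x => (false, psi x, false)).
  have agree y : X y -> mult_of m1 y = (false, psi y, false) by move=> /LX /= ->.
  by have [] := uniq (mult_of m1) (mult_of m2) agree (fun _ _ => erefl) x.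
have := congr1 L ab; rewrite !gmulfM.
move: (L1 a) (L1 b) (L2 a) (L2 b) pa qa pb qb.
by case: (L a) => -[a1 a2 a3]; case: (L b) => -[b1 b2 b3] /= <- <- <- <-;
  case: a1 a2 a3 b1 b2 b3 => [] [] [] [] [] [].
Qed.

(** * The torus band *)

Section Units.
Variables (S : semigroupType) (e : S).
Hypothesis ee : e * e = e.

Definition units_at : set S := [set x | [/\ e * x = x, x * e = x &
  exists y, [/\ e * y = y, y * e = y, x * y = e & y * x = e]]].

Lemma units_at_maximal : maximal_subgroup units_at.
Proof.
have ue : units_at e by split=> //; exists e.
split.
  split=> [x y [ex xe [x' [ex' xe' xx x'x]]] [ey ye [y' [ey' ye' yy y'y]]]|].
    split; rewrite ?mulgA ?ex // -?mulgA ?ye //; exists (y' * x').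
    split; rewrite ?mulgA ?ey' // -?mulgA ?xe' //.
      by rewrite (mulgA y) yy ex'.
    by rewrite (mulgA x') x'x ey.
  exists e; split=> // [x [ex xe _]//|x [ex xe [y [ey ye xy yx]]]].
  by exists y; split=> //; split=> //; exists x.
move=> K [KM [u [Ku uK Kinv]]] sub; apply/seteqP; split=> // x Kx.
have Ke := sub _ ue.
have eu : e = u.
  have [y [Ky ey ye]] := Kinv _ Ke.
  by rewrite -(uK _ Ke).1 -ye -mulgA ee.
have [y [Ky xy yx]] := Kinv _ Kx.
rewrite -eu in uK xy yx.
split; rewrite ?(uK _ Kx).1 ?(uK _ Kx).2 //.
by exists y; rewrite ?(uK _ Ky).1 ?(uK _ Ky).2.
Qed.

End Units.

(** The four idempotents occupy the corners of a square, with e and u, and v and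
    w, in the same rows; the inverse of the loop u v at e goes through the
    opposite corner w. *)
Lemma square_unit (S : semigroupType) (e u v w : S) : e * e = e ->
  e * u = u -> u * e = e -> v * e = v -> e * v = e ->
  u * w = u -> w * u = w -> v * w = w -> w * v = v -> units_at e (u * v).
Proof.
move=> ee eu ue ve ev uw wu vw wv.
split; rewrite ?mulgA ?eu // -?mulgA ?ve //.
exists (e * w * e); split; rewrite ?mulgA ?ee //.
- by rewrite -mulgA ee.
- by rewrite -(mulgA u) ve -(mulgA u) vw uw ue.
- by rewrite -(mulgA (e * w)) eu -(mulgA e) wu -(mulgA e) wv ev.
Qed.

Section TorusBand.
Variables (T : semigroupType) (i : torus_band -> T).
Hypothesis hi : ig_like i.

Lemma torus_letters (c d g : torus_band) :
  c * d = g -> [\/ g = c, g = d, d * c = c | d * c = d] -> i c * i d = i g.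
Proof. by move=> <- h; apply: (ig_mul hi). Qed.

Let o := (false, false).
Let u := (false, true).
Let v := (true, false).
Let w := (true, true).
Let I (r s : bool * bool) : T := i (r, Some s).
Let J (r : bool * bool) : T := i (r, None).

Let e : T := I o o.
(* the two loops of the torus, one in each factor of the band *)
Let a := I u o * I v o.
Let b := I o u * I o v.

Ltac letters := apply: torus_letters;
  [by [] | by [apply: Or41 | apply: Or42 | apply: Or43 | apply: Or44]].

Lemma torus_unit_l : units_at e a.
Proof. by apply: (@square_unit _ _ _ _ (I w o)); letters. Qed.

Lemma torus_unit_r : units_at e b.
Proof. by apply: (@square_unit _ _ _ _ (I o w)); letters. Qed.

(** Both products are deformed to [u, u][v, v].  The steps come from singular
    squares, where an upper letter fixes one side of a square of the lowest class and retracts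
    the square onto it. *)
Lemma torus_commute : a * b = b * a.
Proof.
have -> : a * b = I u u * I v v.
  have h1 : I v o * I o u = I v u.
    have -> : I v o = J v * I o o by apply/esym; letters.
    have h : I o o * I o u = I o u by letters.
    by rewrite -mulgA h; letters.
  have h2 : I u o * I v u = I u u * I v u.
    have {1}-> : I v u = I w u * I v u by apply/esym; letters.
    have -> : I u o = I u o * J u by apply/esym; letters.
    have h : J u * I w u = I u u by letters.
    by rewrite mulgA -(mulgA (I u o)) h; congr (_ * _); letters.
  have h3 : I v u * I o v = I v u * I v v.
    have -> : I v u = I v u * J v by apply/esym; letters.
    rewrite -!mulgA; congr (_ * _).
    have -> : J v * I o v = I v v by letters.
    by apply/esym; letters.
  have h4 : I v u * I v v = I w u * I v v.
    have -> : I v v = I w w * I v v by apply/esym; letters.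
    rewrite !mulgA; congr (_ * _).
    have -> : I w w = J w * I w w by apply/esym; letters.
    rewrite !mulgA; congr (_ * _).
    by transitivity (I w u); [letters | apply/esym; letters].
  have h5 : I u u * I w u = I u u by letters.
  rewrite /a /b !mulgA -(mulgA (I u o)) h1 h2.
  by rewrite -(mulgA (I u u)) h3 h4 mulgA h5.
have h1 : I o v * I u o = I u v.
  have -> : I u o = I o o * J u by apply/esym; letters.
  have h : I o v * I o o = I o v by letters.
  by rewrite mulgA h; letters.
have h2 : I o u * I u v = I u u * I u v.
  have -> : I u v = J u * I u v by apply/esym; letters.
  rewrite !mulgA; congr (_ * _).
  by transitivity (I u u); [letters | apply/esym; letters].
have h3 : I u v * I v o = I u v * I v v.
  have -> : I v o = I w o * J v by apply/esym; letters.
  have -> : I v v = I w v * J v by apply/esym; letters.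
  rewrite !mulgA; congr (_ * _).
  by transitivity (I u v); [letters | apply/esym; letters].
have h4 : I u v * I v v = I u w * I v v.
  have -> : I v v = I w w * I v v by apply/esym; letters.
  rewrite !mulgA; congr (_ * _).
  have -> : I u v = I u v * J u by apply/esym; letters.
  have h : J u * I w w = I u w by letters.
  rewrite -mulgA h.
  by transitivity (I u w); [letters | apply/esym; letters].
have h5 : I u u * I u w = I u u by letters.
by rewrite /a /b !mulgA -(mulgA (I o u)) h1 h2 -(mulgA (I u u)) h3 h4 mulgA h5.
Qed.

(** A homomorphism to Z/2 from a skew product: [A] moves the columns, and [C] is
    the increment of the cocycle. *)
Lemma winding_number (A C : torus_band -> bool -> bool) :
  (forall c d m, basic_pair c d -> A (c * d) m = A d (A c m) /\
     C (c * d) m = C c m (+) C d (A c m)) ->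
  (forall m, A (o, Some o) m = false) ->
  exists phi : T -> bool,
    {in units_at e &, {morph phi : x y / x * y >-> x (+) y}} /\
    forall c d, phi (i c * i d) = C c false (+) C d (A c false).
Proof.
move=> AC Ae; case: hi => _ ind.
case/(_ (bool * bool)%type (fun d s => (A d s.1, s.2 (+) C d s.1))).
  by move=> c d [m k] /AC h /=; rewrite !(h m).1 (h m).2 addbA.
move=> run [run_i run_mul].
have shift x m k :
    run x (m, k) = ((run x (m, false)).1, k (+) (run x (m, false)).2).
  apply: (ind (fun x => forall m k,
    run x (m, k) = ((run x (m, false)).1, k (+) (run x (m, false)).2))).
    by move=> d m' k'; rewrite !run_i.
  move=> y z IHy IHz m' k'; rewrite !run_mul (IHy m' k') (IHz _ (k' (+) _)) /=.
  by rewrite [run y _]surjective_pairing (IHz _ (run y _).2) /= addbA.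
exists (fun x => (run x (false, false)).2); split=> [x y|c d]; last first.
  by rewrite run_mul !run_i.
rewrite !inE => -[_ xe _] _.
have x0 : (run x (false, false)).1 = false by rewrite -xe run_mul run_i /= Ae.
by rewrite run_mul [run x _]surjective_pairing x0 shift.
Qed.

Lemma torus_not_free : ~ is_free_group (units_at e).
Proof.
move=> [G [f [fG finj frange]]].
have fu x : units_at e (f x) by rewrite -frange; exists x.
have [a' _ fa] : range f a by rewrite frange; apply: torus_unit_l.
have [b' _ fb] : range f b by rewrite frange; apply: torus_unit_r.
(* in each factor, the letter (i, l) moves the column m to l and adds i m + i l *)
have [|//|phi [phiM phiE]] := @winding_number (fun d _ => d.1.2)
    (fun d m => (d.1.1 && m) (+) (d.1.1 && d.1.2)).
  move=> [[k l] s] [[k' l'] s'] m /basic_pairP.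
  by case: k l k' l' m s s' => [] [] [] [] [] [[? ?]|] [[? ?]|] [].
have [||psi [psiM psiE]] := @winding_number
    (fun d m => if d.2 is Some s then s.2 else m)
    (fun d m => if d.2 is Some s then (s.1 && m) (+) (s.1 && s.2) else false) => //.
  move=> [r s] [r' s'] m /basic_pairP.
  by case: s s' m => [[[] []]|] [[[] []]|] [] [].
have pM : {morph phi \o f : x y / x * y >-> x (+) y}.
  by move=> x y; rewrite /= gmulfM phiM // inE; apply: fu.
have qM : {morph psi \o f : x y / x * y >-> x (+) y}.
  by move=> x y; rewrite /= gmulfM psiM // inE; apply: fu.
have := free_group_not_commute (a := a') (b := b') pM qM fG.
rewrite /= fa fb /a /b !phiE !psiE => /(_ isT isT isT isT)/eqP; apply.
by apply: finj; rewrite !gmulfM fa fb torus_commute.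
Qed.

End TorusBand.

Theorem theorem1 (V : semigroupType -> Prop) (hV : band_variety V) :
  (forall B : semigroupType, V B ->
     forall H : set (IG B), maximal_subgroup H -> is_free_group H) <->
  ((forall B : semigroupType, V B -> LSNB B) \/
   (forall B : semigroupType, V B -> RSNB B)).
Proof.
split=> [free|[VL|VR] B VB H]; last 2 first.
- exact/LSNB_free/VL.
- exact/RSNB_free/VR.
have [|/existsNP[A /not_implyP[VA nA]]] := pselect (forall B, V B -> LSNB B).
  by left.
have [|/existsNP[B /not_implyP[VB nB]]] := pselect (forall B, V B -> RSNB B).
  by right.
exfalso; have VT := torus_band_in_variety hV VA nA VB nB.
have iT := ig_like_IG torus_band_band.
apply: (torus_not_free iT); apply: free VT _ _; apply: units_at_maximal.
exact: ig_idem torus_band_band iT _.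
Qed.
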